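(* Let $\varphi$ be a satisfiable formula of $\mathrm{SL}( *,\mathrm{reach}^+)$ built over the variables $x_1,\dots,x_q$. Then there is a memory state $(s,h)$ with $(s,h)\models\varphi$ and $|\mathrm{dom}(h)|\le (q^2+q)\cdot(|\varphi|+1)+|\varphi|$, where $|\varphi|$ is the tree size of $\varphi$.
   Context: A memory state is $(s,h)$ with $s:\mathrm{PVAR}\to\mathrm{LOC}$ ($\mathrm{PVAR}$, $\mathrm{LOC}$ countably infinite) and $h$ a partial function $\mathrm{LOC}\to\mathrm{LOC}$ with finite domain $\mathrm{dom}(h)$. $h^0=\mathrm{id}$, $h^{n+1}(l)=h(h^n(l))$ when defined. $\mathrm{SL}( *,\mathrm{reach}^+)$ has atoms $x=y$, $x\hookrightarrow y$, $\mathrm{emp}$, $\mathrm{reach}^+(x,y)$ and connectives $\neg,\wedge,*$, with semantics: $(s,h)\models x=y$ iff $s(x)=s(y)$; $\mathrm{emp}$ iff $\mathrm{dom}(h)=\emptyset$; $x\hookrightarrow y$ iff $s(x)\in\mathrm{dom}(h)$ and $h(s(x))=s(y)$; $\mathrm{reach}^+(x,y)$ iff $h^i(s(x))=s(y)$ for some $i\ge1$; $\varphi_1*\varphi_2$ iff $h=h_1+h_2$ for heaps with disjoint domains with $(s,h_1)\models\varphi_1$ and $(s,h_2)\models\varphi_2$. The tree size $|\varphi|$ is the number of nodes of the syntax tree of $\varphi$. *)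

(* Defs.v *)
From mathcomp Require Import all_boot.
From mathcomp Require Import finmap.

Set Implicit Arguments.
Unset Strict Implicit.
Unset Printing Implicit Defensive.

Local Open Scope fset_scope.
Local Open Scope fmap_scope.

Definition countably_infinite (T : Type) : Prop :=
  exists f : nat -> T, bijective f.

Inductive form (PVAR : Type) : Type :=
| Eq of PVAR & PVAR
| PointsTo of PVAR & PVAR
| Emp
| ReachPlus of PVAR & PVAR
| Neg of form PVAR
| And of form PVAR & form PVAR
| Star of form PVAR & form PVAR.

Arguments Emp {PVAR}.

(* Atomic formulae are the leaves of the syntax tree: each counts for one
   node, whatever variables it mentions. *)
Fixpoint tree_size (PVAR : Type) (phi : form PVAR) : nat :=
  match phi with
  | Eq _ _ | PointsTo _ _ | Emp | ReachPlus _ _ => 1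
  | Neg psi => (tree_size psi).+1
  | And psi1 psi2 | Star psi1 psi2 => (tree_size psi1 + tree_size psi2).+1
  end.

Fixpoint form_vars (PVAR : Type) (phi : form PVAR) : seq PVAR :=
  match phi with
  | Eq x y | PointsTo x y | ReachPlus x y => [:: x; y]
  | Emp => [::]
  | Neg psi => form_vars psi
  | And psi1 psi2 | Star psi1 psi2 => form_vars psi1 ++ form_vars psi2
  end.

Section Semantics.
Variables (PVAR : Type) (LOC : choiceType).

Definition store : Type := PVAR -> LOC.

Definition heap : Type := {fmap LOC -> LOC}.

(* h^n (l), with None when it is undefined. *)
Fixpoint heap_iter (h : heap) (n : nat) (l : LOC) : option LOC :=
  if n is m.+1 then obind (fun l' => h.[? l']) (heap_iter h m l) else Some l.

(* On heaps with disjoint domains, h1 + h2 (the right-biased union of finite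
   maps) is the disjoint union. *)
Fixpoint sat (s : store) (h : heap) (phi : form PVAR) : Prop :=
  match phi with
  | Eq x y => s x = s y
  | PointsTo x y => h.[? s x] = Some (s y)
  | Emp => domf h = fset0
  | ReachPlus x y => exists i : nat, 1 <= i /\ heap_iter h i (s x) = Some (s y)
  | Neg psi => ~ sat s h psi
  | And psi1 psi2 => sat s h psi1 /\ sat s h psi2
  | Star psi1 psi2 =>
      exists h1 h2 : heap,
        [/\ [disjoint domf h1 & domf h2], h = h1 + h2,
            sat s h1 psi1 & sat s h2 psi2]
  end.

End Semantics.

Definition satisfiable (PVAR : Type) (LOC : choiceType) (phi : form PVAR) :
  Prop := exists (s : store PVAR LOC) (h : heap LOC), sat s h phi.

(* Main.v *)
Require Import Defs.
From mathcomp Require Import all_boot.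
From mathcomp Require Import finmap.
From mathcomp Require Import zify.
From mathcomp Require Import boolp.

(** Keep the store fixed and mark at most [2 q] locations of a model [h]: the
    values of the variables, and the locations where the path from one variable
    first runs into the paths of the previous ones or into itself.  Call [P] the
    set of marked locations.  The paths leading from each [p] in [P] to its first
    return to [P] are pairwise disjoint blocks of cells; every other cell is
    garbage.  Two heaps are similar at rank [n] when from every point of [P] they
    return first to the same point, after the same number of steps up to [n + 1],
    and they have the same amount of garbage up to [n].

    Similarity at rank [|phi|] preserves [phi].  For the separating conjunction,
    a splitting of one heap is copied on the other block by block, only matching
    cardinalities: a block that is not contained in one of the two parts turns
    into garbage on both sides, so [P] never has to be changed.  Finally, cutting
    every block after [n + 1] cells and keeping [n] cells of garbage gives a
    similar heap of the required size. *)

Set Implicit Arguments.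
Unset Strict Implicit.
Unset Printing Implicit Defensive.

Local Open Scope fset_scope.
Local Open Scope fmap_scope.
Local Open Scope nat_scope.

(** * Truncated equality and cardinalities of finite sets *)

(** Either [a = b] or both are at least [n]. *)
Definition eq_upto (n a b : nat) : Prop := minn n a = minn n b.

Lemma eq_upto_sum (I : eqType) (r : seq I) n (F G : I -> nat) :
  (forall i, i \in r -> eq_upto n (F i) (G i)) ->
  eq_upto n (\sum_(i <- r) F i) (\sum_(i <- r) G i).
Proof.
move=> FG; rewrite big_seq [in X in eq_upto _ _ X]big_seq.
by elim/big_ind2: _ => // a b c d; rewrite /eq_upto; lia.
Qed.

(** Divides [c] the way [a + b] is divided: a small part is copied exactly and the other one takes
    the rest; when both are large, [c] is at least [n1 + n2] and any division into parts at least
    [n1] and [n2] would do. *)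
Definition split_card (n1 n2 a b c : nat) : nat :=
  if a < n1 then a else if b < n2 then c - b else n1.

Lemma split_cardP n1 n2 a b c : eq_upto (n1 + n2) (a + b) c ->
  [/\ split_card n1 n2 a b c <= c, eq_upto n1 a (split_card n1 n2 a b c)
    & eq_upto n2 b (c - split_card n1 n2 a b c)].
Proof.
by rewrite /eq_upto /split_card; case: ifP => ?; [|case: ifP => ?]; split; lia.
Qed.

Lemma fsubset_of_card (K : choiceType) (A : {fset K}) k : k <= #|` A| ->
  exists2 A' : {fset K}, A' `<=` A & #|` A'| = k.
Proof.
move=> kA; exists [fset x in take k A].
  by apply/fsubsetP => x; rewrite inE => /mem_take.
by rewrite card_fseq undup_id ?size_takel // take_uniq.
Qed.

Lemma card_remainder (K : choiceType) (P : {fset K}) (B : K -> {fset K})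
    (D : {fset K}) :
  {in P &, forall p r, p != r -> [disjoint B p & B r]} ->
  #|` D `\` \bigcup_(p <- P) B p| + \sum_(p <- P) #|` D `&` B p| = #|` D|.
Proof.
move=> dB; have : uniq (enum_fset P) by [].
have {dB} : {in enum_fset P &, forall p r, p != r -> [disjoint B p & B r]} by [].
elim: (enum_fset P) => [|p s IH] dB /=.
  by rewrite !big_nil fsetD0 addn0.
case/andP=> ps us; rewrite !big_cons -[RHS](IH _ us); last first.
  by move=> q r qs rs; apply: dB; rewrite inE ?qs ?rs orbT.
rewrite addnA; congr (_ + _).
rewrite -[RHS](cardfsID (B p)) addnC; congr (_ + _); congr #|` _|; last first.
  by apply/fsetP => x; rewrite !inE negb_or andbA.
apply/fsetP => x; rewrite !inE; case xB: (x \in B p); rewrite ?andbF ?andbT //.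
rewrite andbC; case: (x \in D) => //=; apply/esym/bigfcupP => -[r].
rewrite andbT => rs xr; have /fdisjointP/(_ x xB) : [disjoint B p & B r].
  by apply: dB; rewrite ?mem_head // ?inE ?rs ?orbT //; apply: contraNneq ps => ->.
by rewrite xr.
Qed.

Lemma split_fset (K : choiceType) n1 n2 (S S' D : {fset K}) :
  eq_upto (n1 + n2) #|` S| #|` S'| ->
  exists2 A, A `<=` S' &
    eq_upto n1 #|` D `&` S| #|` A| /\ eq_upto n2 #|` S `\` D| #|` S' `\` A|.
Proof.
rewrite -(cardfsID D S) fsetIC => /split_cardP[le e1 e2].
have [A AS cA] := fsubset_of_card le.
by exists A => //; rewrite (cardfsDS AS) cA.
Qed.

Lemma fsetD_capr (K : choiceType) (S D : {fset K}) : S `\` (D `&` S) = S `\` D.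
Proof. by rewrite fsetIC fsetDIr fsetDv fset0U. Qed.

Lemma fsetD_diff (K : choiceType) (S D : {fset K}) : S `\` (S `\` D) = D `&` S.
Proof. by rewrite fsetDDr fsetDv fset0U fsetIC. Qed.

Lemma fsubset_cardD (K : choiceType) (S D : {fset K}) :
  (S `<=` D) = (#|` S `\` D| == 0).
Proof. by rewrite cardfs_eq0 fsetD_eq0. Qed.

Lemma tree_size_gt0 (PVAR : Type) (phi : form PVAR) : 0 < tree_size phi.
Proof. by case: phi. Qed.

Section Heaps.
Variable LOC : choiceType.
Implicit Types (h : heap LOC) (l m p r : LOC) (P T B : {fset LOC}).

(** * Iteration, subheaps and blocks *)

Lemma heap_iterD h i j l :
  heap_iter h (i + j) l = obind (heap_iter h j) (heap_iter h i l).
Proof.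
elim: j => [|j IH]; first by rewrite addn0; case: (heap_iter h i l).
by rewrite addnS /= IH; case: (heap_iter h i l).
Qed.

Lemma heap_iter_prefix h i j p r : j < i -> heap_iter h i p = Some r ->
  exists2 l, heap_iter h j p = Some l & l \in domf h.
Proof.
move=> ji; rewrite -(subnKC ji) heap_iterD /=.
case: (heap_iter h j p) => //= l.
by case: fndP => // ld _; exists l.
Qed.

Definition subheap h1 h : Prop :=
  forall l m, h1.[? l] = Some m -> h.[? l] = Some m.

Lemma subheap_catl h1 h2 : [disjoint domf h1 & domf h2] ->
  subheap h1 (h1 + h2)%fset.
Proof.
move=> d l m e; rewrite fnd_cat ifN //.
by apply: (fdisjointP d); rewrite -fndSome e.
Qed.

Lemma subheap_catr h1 h2 : subheap h2 (h1 + h2)%fset.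
Proof. by move=> l m e; rewrite fnd_cat ifT // -fndSome e. Qed.

Lemma subheap_restrict h A : subheap h.[& A] h.
Proof. by move=> l m; rewrite fnd_restrict; case: ifP. Qed.

Lemma domf_subheap h1 h : subheap h1 h -> domf h1 `<=` domf h.
Proof.
move=> hh; apply/fsubsetP => l; rewrite -!fndSome.
by case e: h1.[? l] => [m|] // _; rewrite (hh _ _ e).
Qed.

Lemma heap_iter_sub h1 h i p r : subheap h1 h ->
  heap_iter h1 i p = Some r -> heap_iter h i p = Some r.
Proof.
move=> hh; elim: i r => [|i IH] r //=.
by case e: (heap_iter h1 i p) => [l|] //= /hh; rewrite (IH _ e).
Qed.

(* [B] is the set of cells on the path from [p] to its first return to [P],
   and [t] is the location of that return; when the path never returns to [P],
   [B] is empty and [t] is irrelevant. *)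
Record block P h p B t : Prop := Block {
  block_exit : 0 < #|` B| -> t \in P /\ heap_iter h #|` B| p = Some t;
  block_cells : forall l,
    l \in B <-> exists2 i, i < #|` B| & heap_iter h i p = Some l;
  block_first : forall i r, 0 < i -> heap_iter h i p = Some r -> r \in P ->
    0 < #|` B| <= i }.

Lemma block_subheap P h1 h p B t : subheap h1 h -> block P h p B t ->
  block P h1 p (if B `<=` domf h1 then B else fset0) t.
Proof.
move=> hh [ex ce fi]; case: ifPn => [Bh1|nBh1].
  have E i : i <= #|` B| -> heap_iter h1 i p = heap_iter h i p.
    elim: i => [//|i IH] ib /=; rewrite IH 1?ltnW //.
    case e: (heap_iter h i p) => [l|] //=.
    have /(fsubsetP Bh1) : l \in B by apply/ce; exists i.
    by rewrite -fndSome; case e1: h1.[? l] => [m|] // _; rewrite (hh _ _ e1).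
  split.
  - by rewrite E.
  - move=> l; rewrite ce; split=> -[i ib]; first by rewrite -E 1?ltnW //; exists i.
    by rewrite E 1?ltnW //; exists i.
  - by move=> i r i0 /(heap_iter_sub hh); apply: fi.
split; first by rewrite cardfs0.
  by move=> l; rewrite cardfs0 inE; split=> // -[].
move=> i r i0 e rP; case/negP: nBh1; apply/fsubsetP => l /ce [j jb ej].
have /andP[_ bi] := fi _ _ i0 (heap_iter_sub hh e) rP.
have [l' e' l'd] := heap_iter_prefix (leq_trans jb bi) e.
by move: (heap_iter_sub hh e'); rewrite ej => -[->].
Qed.

Lemma block_dom P h p B t : block P h p B t -> B `<=` domf h.
Proof.
case=> ex ce _; apply/fsubsetP => l /ce [i ib e].
have [_ e'] := ex (leq_ltn_trans (leq0n i) ib).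
by have [l'] := heap_iter_prefix ib e'; rewrite e => -[->].
Qed.

(** * Decompositions into blocks and garbage *)

Record decomp P h (B : LOC -> {fset LOC}) (t : LOC -> LOC) : Prop := Decomp {
  decomp_block : forall p, p \in P -> block P h p (B p) (t p);
  decomp_disj : {in P &, forall p r, p != r -> [disjoint B p & B r]} }.

Definition garbage P h (B : LOC -> {fset LOC}) : {fset LOC} :=
  domf h `\` \bigcup_(p <- P) B p.

Lemma garbage_disj P h (B : LOC -> {fset LOC}) p :
  p \in P -> [disjoint garbage P h B & B p].
Proof.
move=> pP; rewrite fdisjoint_sym; apply/fdisjointP => l lB; rewrite !inE.
by rewrite negb_and negbK; apply/orP; left; apply/bigfcupP; exists p; rewrite ?pP.
Qed.

Definition restrict_blocks h (B : LOC -> {fset LOC}) p : {fset LOC} :=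
  if B p `<=` domf h then B p else fset0.

Lemma decomp_subheap P h1 h (B : LOC -> {fset LOC}) t : subheap h1 h ->
  decomp P h B t -> decomp P h1 (restrict_blocks h1 B) t.
Proof.
move=> hh [bl dj]; split=> [p pP|p r pP rP pr].
  exact: block_subheap (bl _ pP).
rewrite /restrict_blocks; case: ifP; case: ifP => _ _; last 2 first.
- by rewrite fdisjoint0X.
- by rewrite fdisjoint0X.
- exact: dj.
- by rewrite fdisjointX0.
Qed.

(** The garbage of [h1] is inherited from [h] or comes from broken blocks. The proof counts
    [domf h1] with the old blocks and with the restricted ones. *)
Lemma card_garbage_subheap P h1 h (B : LOC -> {fset LOC}) t : subheap h1 h ->
  decomp P h B t ->
  #|` garbage P h1 (restrict_blocks h1 B)| =
  #|` domf h1 `&` garbage P h B|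
  + \sum_(p <- P) (if B p `<=` domf h1 then 0 else #|` domf h1 `&` B p|).
Proof.
move=> hh dc; have [_ dj] := dc.
have [_ dj1] := decomp_subheap hh dc.
have := card_remainder (domf h1) dj1; have := card_remainder (domf h1) dj.
have -> : domf h1 `&` garbage P h B = domf h1 `\` \bigcup_(p <- P) B p.
  apply/fsetP => l; rewrite !inE.
  case e: (l \in domf h1); rewrite ?andbF //=.
  by rewrite (fsubsetP (domf_subheap hh)) ?e // andbT.
have -> : \sum_(p <- P) #|` domf h1 `&` B p| =
    \sum_(p <- P) #|` domf h1 `&` restrict_blocks h1 B p| +
    \sum_(p <- P) (if B p `<=` domf h1 then 0 else #|` domf h1 `&` B p|).
  rewrite -big_split /=; apply: eq_bigr => p _; rewrite /restrict_blocks.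
  by case: ifP; rewrite ?addn0 // fsetI0 cardfs0.
rewrite /garbage; lia.
Qed.

(** * Similarity of heaps and its behaviour under splitting *)

(** Blocks get the threshold [n.+1] so that rank 1 already separates a block of one cell, seen by
    [PointsTo], from a longer one. Sharing [t] makes corresponding blocks exit at the same point. *)
Definition sim P n h h' : Prop :=
  exists (B B' : LOC -> {fset LOC}) (t : LOC -> LOC),
    [/\ decomp P h B t, decomp P h' B' t,
        forall p, p \in P -> eq_upto n.+1 #|` B p| #|` B' p|
      & eq_upto n #|` garbage P h B| #|` garbage P h' B'|].

Lemma sim_sym P n h h' : sim P n h h' -> sim P n h' h.
Proof.
move=> [B [B' [t [dc dc' eB eg]]]]; exists B', B, t; split=> // p /eB.
exact: esym.
Qed.

(** Corresponding blocks are both kept or both broken; the broken ones add to the garbage amounts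
    that agree up to [n], and truncated equality is stable under sums. *)
Lemma sim_subheap P n h h' h1 h1' (B B' : LOC -> {fset LOC}) t :
  subheap h1 h -> subheap h1' h' -> decomp P h B t -> decomp P h' B' t ->
  (forall p, p \in P -> [/\ eq_upto n.+1 #|` B p| #|` B' p|,
    eq_upto n #|` domf h1 `&` B p| #|` domf h1' `&` B' p|
    & (B p `<=` domf h1) = (B' p `<=` domf h1')]) ->
  eq_upto n #|` domf h1 `&` garbage P h B| #|` domf h1' `&` garbage P h' B'| ->
  sim P n h1 h1'.
Proof.
move=> hh hh' dc dc' eB eg.
exists (restrict_blocks h1 B), (restrict_blocks h1' B'), t; split.
- exact: decomp_subheap dc.
- exact: decomp_subheap dc'.
- move=> p /eB[e _ es]; rewrite /restrict_blocks es.
  by case: ifP => _ //; rewrite /eq_upto cardfs0.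
rewrite (card_garbage_subheap hh dc) (card_garbage_subheap hh' dc').
have : eq_upto n
  (\sum_(p <- P) (if B p `<=` domf h1 then 0 else #|` domf h1 `&` B p|))
  (\sum_(p <- P) (if B' p `<=` domf h1' then 0 else #|` domf h1' `&` B' p|)).
  by apply: eq_upto_sum => p /eB[_ e es]; rewrite es; case: ifP.
move: eg; rewrite /eq_upto; lia.
Qed.


(** Each block and the garbage are split independently by [split_fset]. Positivity of [n1] and [n2]
    lets the truncated counts detect whether a part is empty, that is, whether a block lies entirely
    in the other part. *)
Lemma sim_split P n n1 n2 h h' h1 h2 :
  0 < n1 -> 0 < n2 -> n1 + n2 <= n -> sim P n h h' ->
  [disjoint domf h1 & domf h2] -> h = (h1 + h2)%fset ->
  exists h1' h2', [/\ [disjoint domf h1' & domf h2'], h' = (h1' + h2')%fset,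
    sim P n1 h1 h1' & sim P n2 h2 h2'].
Proof.
move=> n1_gt0 n2_gt0 n12 [B [B' [t [dc dc' eB eg]]]] d12 eh.
have sub1 : subheap h1 h by rewrite eh; apply: subheap_catl.
have sub2 : subheap h2 h by rewrite eh; apply: subheap_catr.
have D2 (S : {fset LOC}) : S `<=` domf h -> domf h2 `&` S = S `\` domf h1.
  move=> Sh; apply/fsetP => l; rewrite !inE andbC.
  case lS: (l \in S); rewrite ?andbF //= andbT.
  have := fsubsetP Sh l lS; rewrite eh mem_catf.
  case/orP => [l1|l2].
    by rewrite (negbTE (fdisjointP d12 l l1)) [l \in domf h1]l1.
  by move: d12; rewrite fdisjoint_sym [l \in domf h2]l2 => /fdisjointP ->.
have Bh p : p \in P -> B p `<=` domf h by case/(decomp_block dc)/block_dom.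
have Bh' p : p \in P -> B' p `<=` domf h' by case/(decomp_block dc')/block_dom.
have /choice[A AP] : forall p, exists A, p \in P -> A `<=` B' p /\
    (eq_upto n1 #|` domf h1 `&` B p| #|` A| /\
     eq_upto n2 #|` B p `\` domf h1| #|` B' p `\` A|).
  move=> p; case pP: (p \in P); last by exists fset0.
  have [|A AB e] := @split_fset _ n1 n2 (B p) (B' p) (domf h1).
    by move: (eB _ pP); rewrite /eq_upto; lia.
  by exists A.
have [|G GS [eG1 eG2]] :=
    @split_fset _ n1 n2 (garbage P h B) (garbage P h' B') (domf h1).
  by move: eg; rewrite /eq_upto; lia.
(* The domain of the copy of [h1]; as the pieces are disjoint, it meets each of them exactly in the
   part chosen there. *)
pose D := G `|` \bigcup_(p <- P) A p.
have DG : D `&` garbage P h' B' = G.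
  apply/fsetP => l; rewrite in_fsetI in_fsetU.
  case lG: (l \in G) => /=; first by rewrite (fsubsetP GS).
  apply/negbTE; rewrite negb_and; apply/orP.
  case: bigfcupP => [[p]|]; last by left.
  rewrite andbT => pP lA; right; have [/fsubsetP/(_ _ lA) lB _] := AP _ pP.
  by apply/negP => /(fdisjointP (garbage_disj h' B' pP)); rewrite lB.
have DB p : p \in P -> D `&` B' p = A p.
  move=> pP; have [AB _] := AP _ pP; apply/fsetP => l; rewrite in_fsetI in_fsetU.
  case lA: (l \in A p).
    rewrite (fsubsetP AB) // andbT; apply/orP; right; apply/bigfcupP.
    by exists p; rewrite ?pP.
  apply/negbTE; rewrite negb_and -implybE; apply/implyP => /orP[lG|].
    exact: (fdisjointP (garbage_disj h' B' pP)) (fsubsetP GS _ lG).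
  case/bigfcupP => r; rewrite andbT => rP lr; have [ABr _] := AP _ rP.
  have [pr|pr] := eqVneq r p; first by rewrite pr lA in lr.
  exact: (fdisjointP (decomp_disj dc' rP pP pr)) (fsubsetP ABr _ lr).
have d1 : domf h'.[& D] = D.
  rewrite domf_restrict; apply/fsetIidPl; rewrite fsubUset.
  rewrite (fsubset_trans GS (fsubsetDl _ _)) /=; apply/bigfcupsP => p pP _.
  by have [AB _] := AP _ pP; apply: fsubset_trans (Bh' _ pP).
have d2 (S : {fset LOC}) : S `<=` domf h' -> domf h'.[\ D] `&` S = S `\` D.
  move=> Sh; apply/fsetP => l; rewrite domf_restrict !in_fsetI !in_fsetD.
  case lS: (l \in S); rewrite ?andbF //= !andbT.
  by rewrite (fsubsetP Sh) // !andbT.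
exists h'.[& D], h'.[\ D]; split.
- rewrite d1; apply/fdisjointP => l lD; rewrite domf_restrict ?in_fsetI ?in_fsetD.
  by rewrite negb_and lD.
- apply/fmapP => l; rewrite fnd_cat fnd_rem fnd_restrict.
  rewrite domf_restrict in_fsetI in_fsetD.
  by case: (l \in D) => //=; case: fndP.
- apply: sim_subheap dc dc' _ _; rewrite ?d1 ?DG //.
    exact: subheap_restrict.
  move=> p pP; have [_ [e1 e2]] := AP _ pP; rewrite DB //.
  split=> //; first by move: (eB _ pP); rewrite /eq_upto; lia.
  (* Containment means that the leftover is empty, which [e2] detects because [n2] is positive. *)
  rewrite !fsubset_cardD -[B' p `\` D]fsetD_capr DB //.
  by move: e2; rewrite /eq_upto; lia.
- apply: sim_subheap dc dc' _ _ => //.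
  + exact: subheap_restrict.
  + move=> p pP; have [_ [e1 e2]] := AP _ pP; rewrite D2 ?d2 ?Bh ?Bh' //.
    rewrite -[B' p `\` D]fsetD_capr DB //.
    split=> //; first by move: (eB _ pP); rewrite /eq_upto; lia.
    rewrite !fsubset_cardD -fsetD_capr D2 ?Bh // fsetD_diff.
    rewrite -[B' p `\` domf _]fsetD_capr d2 ?Bh' // fsetD_diff DB //.
    by move: e1; rewrite /eq_upto; lia.
  rewrite D2 ?fsubsetDl // d2 ?fsubsetDl //.
  by rewrite -[garbage P h' B' `\` D]fsetD_capr DG.
Qed.


(** * Similar heaps satisfy the same formulae *)

(** The path is cut at its successive returns to [P]. Each block has a nonempty counterpart with the
    same exit, though possibly of another length. *)
Lemma sim_reach P n h h' i p r : sim P n h h' -> p \in P -> r \in P ->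
  0 < i -> heap_iter h i p = Some r ->
  exists2 i', 0 < i' & heap_iter h' i' p = Some r.
Proof.
move=> [B [B' [t [dc dc' eB _]]]] pP rP.
elim/ltn_ind: i p pP => i IH p pP i0 e.
have [ex _ fi] := decomp_block dc pP; have [ex' _ _] := decomp_block dc' pP.
have /andP[B0 Bi] := fi _ _ i0 e rP; have [tP et] := ex B0.
have B'0 : 0 < #|` B' p| by move: (eB _ pP); rewrite /eq_upto; lia.
have [_ et'] := ex' B'0.
move: e; rewrite -(subnKC Bi) heap_iterD et /=.
have [-> [<-]|k0 e] := posnP (i - #|` B p|); first by exists #|` B' p|.
have [|i' i'0 e'] := IH _ _ _ tP k0 e; first lia.
by exists (#|` B' p| + i'); rewrite ?heap_iterD ?et' //; lia.
Qed.

(** As [r] is in [P], the block of [p] has exactly one cell, and a threshold of at least 2 transfers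
    this length. *)
Lemma sim_points_to P n h h' p r : 0 < n -> sim P n h h' ->
  p \in P -> r \in P -> h.[? p] = Some r -> h'.[? p] = Some r.
Proof.
move=> n0 [B [B' [t [dc dc' eB _]]]] pP rP e.
have [ex _ fi] := decomp_block dc pP; have [ex' _ _] := decomp_block dc' pP.
have /andP[B0 B1] := fi 1 r isT e rP; have [tP et] := ex B0.
have {}B1 : #|` B p| = 1 by lia.
have B'1 : #|` B' p| = 1 by move: (eB _ pP); rewrite /eq_upto; lia.
move: et ex'; rewrite B1 B'1 /= e => -[->] ex'.
by case: (ex' isT).
Qed.

Lemma sim_empty P n h h' : 0 < n -> sim P n h h' ->
  domf h = fset0 -> domf h' = fset0.
Proof.
move=> n0 [B [B' [t [dc dc' eB eg]]]] h0.
have B'0 p : p \in P -> B' p = fset0.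
  move=> pP; apply/cardfs0_eq; have := block_dom (decomp_block dc pP).
  rewrite h0 fsubset0 => /eqP B0; move: (eB _ pP); rewrite B0 cardfs0.
  by rewrite /eq_upto; lia.
move: eg; rewrite /garbage h0 fset0D cardfs0 big_seq big1 // fsetD0.
by rewrite /eq_upto => eg; apply/cardfs0_eq; lia.
Qed.

Lemma sim_le P n1 n h h' : n1 <= n -> sim P n h h' -> sim P n1 h h'.
Proof.
move=> n1n [B [B' [t [dc dc' eB eg]]]]; exists B, B', t; split=> //.
  by move=> p /eB; rewrite /eq_upto; lia.
by move: eg; rewrite /eq_upto; lia.
Qed.

(** Induction on [phi]: negation uses the symmetry of similarity, and a star shares its rank between
    its two arguments, whose sizes are positive. *)
Lemma sim_sat (PVAR : choiceType) (s : store PVAR LOC) P (phi : form PVAR) h h' :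
  (forall x, x \in form_vars phi -> s x \in P) ->
  sim P (tree_size phi) h h' -> sat s h phi -> sat s h' phi.
Proof.
elim: phi h h' => /= [x y|x y||x y|psi IH|psi1 IH1 psi2 IH2|psi1 IH1 psi2 IH2]
  h h' sP hh' //.
- by apply: sim_points_to hh' _ _; rewrite ?sP ?inE ?eqxx ?orbT.
- exact: sim_empty hh'.
- case=> i [i0 e].
  have [||i' i'0 e'] := sim_reach hh' _ _ i0 e; rewrite ?sP ?inE ?eqxx ?orbT //.
  by exists i'.
- move=> nh h'psi; apply: nh; apply: IH h'psi => //.
  exact/sim_sym/(sim_le _ hh').
- case=> h1 h2; split.
    apply: IH1 h1 => [x xv|]; first by rewrite sP // mem_cat xv.
    by apply: sim_le hh'; lia.
  apply: IH2 h2 => [x xv|]; first by rewrite sP // mem_cat xv orbT.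
  by apply: sim_le hh'; lia.
- case=> h1 [h2 [d12 eh s1 s2]].
  have [|h1' [h2' [d12' eh' sim1 sim2]]] :=
    sim_split (tree_size_gt0 psi1) (tree_size_gt0 psi2) _ hh' d12 eh; first lia.
  exists h1', h2'; split=> //.
    by apply: IH1 s1 => // x xv; rewrite sP // mem_cat xv.
  by apply: IH2 s2 => // x xv; rewrite sP // mem_cat xv orbT.
Qed.

(** * Choice of the marked locations *)

(** [T] is a region closed under [h] in which paths can merge only at points of [P]; this is what
    keeps the blocks disjoint. *)
Record marking h P T : Prop := Marking {
  marking_sub : P `<=` T;
  marking_closed : forall l m, l \in T -> h.[? l] = Some m -> m \in T;
  marking_merge : forall l l' m, l \in T -> l' \in T -> l != l' ->
    h.[? l] = Some m -> h.[? l'] = Some m -> m \in P }.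

(* Following the path from [c] until it meets [T] again creates at most one new
   merging point. *)
Lemma marking_walk h P T c : P `<=` T -> c \in T ->
  (forall l m, l \in T -> l != c -> h.[? l] = Some m -> m \in T) ->
  (forall l l' m, l \in T -> l' \in T -> l != c -> l' != c -> l != l' ->
    h.[? l] = Some m -> h.[? l'] = Some m -> m \in P) ->
  exists P' T', [/\ marking h P' T', P `<=` P', T `<=` T' & #|` P'| <= #|` P|.+1].
Proof.
(* The end [c] of the walk is the only location of [T] exempt from the conditions. Each step puts a
   new value of [h] into [T], so the walk terminates. *)
have [k] := ubnP #|` codomf h `\` T|; elim: k => // k IH in T c *.
move=> ck PT cT Tcl Tm; case e: h.[? c] => [m|]; last first.
  exists P, T; split=> //; split=> // [l m lT|l l' m lT l'T ll' el el'].
    by have [->|lc] := eqVneq l c; rewrite ?e //; apply: Tcl.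
  have lc : l != c by apply: contra_eqN el => /eqP ->; rewrite e.
  have l'c : l' != c by apply: contra_eqN el' => /eqP ->; rewrite e.
  exact: Tm ll' el el'.
case mT: (m \in T).
  (* The walk runs into [T] at [m], the only possible new merging point. *)
  exists (m |` P), T; split; rewrite ?fsubsetU1 ?cardfsU1 //; last by case: (_ \notin _).
  split=> [|l m' lT|l l' m' lT l'T ll' el el'].
  - by rewrite fsubUset fsub1set mT.
  - by have [->|lc] := eqVneq l c; [rewrite e => -[<-]|apply: Tcl].
  rewrite !inE; have [lc|lc] := eqVneq l c.
    by move: el; rewrite lc e => -[->]; rewrite eqxx.
  have [l'c|l'c] := eqVneq l' c.
    by move: el'; rewrite l'c e => -[->]; rewrite eqxx.
  by rewrite (Tm _ _ _ lT l'T lc l'c ll' el el') orbT.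
have mc : m \in codomf h by apply/codomfP; exists c.
(* Otherwise [m] is the new end. No other location of [T] points to it, since [T] is closed away
   from [c] and [m] is outside [T]. *)
have [|||||P' [T' [mk PP' TT' cP']]] := IH (m |` T) m.
- rewrite ltnS in ck; apply: leq_trans ck.
  have -> : codomf h `\` (m |` T) = (codomf h `\` T) `\ m.
    by apply/fsetP => l; rewrite !inE negb_or andbA.
  by rewrite [X in _ <= X](cardfsD1 m) in_fsetD mc mT.
- exact: fsubset_trans PT (fsubsetU1 _ _).
- by rewrite fset1U1.
- move=> l m'; rewrite in_fset1U => /orP[->//|lT] lm el; rewrite in_fset1U.
  have [lc|lc] := eqVneq l c; last by rewrite (Tcl _ _ lT lc el) orbT.
  by move: el; rewrite lc e => -[->]; rewrite eqxx.
- move=> l l' m'; rewrite !in_fset1U => lT l'T lm l'm ll' el el'.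
  rewrite (negbTE lm) /= in lT; rewrite (negbTE l'm) /= in l'T.
  have [lc|lc] := eqVneq l c.
    have l'c : l' != c by rewrite -lc eq_sym.
    move: el; rewrite lc e => -[em]; move: (Tcl _ _ l'T l'c el').
    by rewrite -em mT.
  have [l'c|l'c] := eqVneq l' c.
    by move: el'; rewrite l'c e => -[em]; move: (Tcl _ _ lT lc el); rewrite -em mT.
  exact: Tm lc l'c ll' el el'.
by exists P', T'; split=> //; apply: fsubset_trans TT'; apply: fsubsetU1.
Qed.

(** Each entry contributes itself and at most one merging point. *)
Lemma marking_exists h (xs : seq LOC) : exists P T,
  [/\ marking h P T, {subset xs <= P} & #|` P| <= 2 * size xs].
Proof.
elim: xs => [|x xs [P [T [mk xsP cP]]]].
  by exists fset0, fset0; split=> //; rewrite ?cardfs0.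
have [PT cl mg] := mk; case xT: (x \in T).
  exists (x |` P), T; split.
  - split=> // [|l l' m lT l'T ll' el el'].
      by rewrite fsubUset fsub1set xT.
    by rewrite in_fset1U (mg _ _ _ lT l'T ll' el el') orbT.
  - by move=> y; rewrite in_cons in_fset1U => /orP[->|/xsP ->]; rewrite ?orbT.
  by rewrite cardfsU1 /=; case: (_ \notin _); lia.
have [||||P' [T' [mk' PP' TT' cP']]] := @marking_walk h (x |` P) (x |` T) x.
- exact: fsetUS.
- exact: fset1U1.
- move=> l m; rewrite !in_fset1U => /orP[->//|lT] _ el.
  by rewrite (cl _ _ lT el) orbT.
- move=> l l' m; rewrite !in_fset1U => lT l'T lx l'x ll' el el'.
  rewrite (negbTE lx) /= in lT; rewrite (negbTE l'x) /= in l'T.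
  by rewrite (mg _ _ _ lT l'T ll' el el') orbT.
exists P', T'; split=> //.
  move=> y yx; apply: (fsubsetP PP'); rewrite in_fset1U.
  by move: yx; rewrite in_cons => /orP[->|/xsP ->]; rewrite ?orbT.
by apply: leq_trans cP' _; rewrite cardfsU1 /=; case: (_ \notin _); lia.
Qed.


(** * Construction of the blocks *)

(** The default [p] is never taken when [heap_iter h a p] is defined. *)
Definition path_cells h p a : {fset LOC} :=
  [fset l in [seq odflt p (heap_iter h i p) | i <- iota 0 a]].

Lemma path_cellsP h p a r l : heap_iter h a p = Some r ->
  l \in path_cells h p a <-> exists2 i, i < a & heap_iter h i p = Some l.
Proof.
move=> ea; rewrite inE; split=> [/mapP[i]|[i ia ei]].
  rewrite mem_iota /= => ia ->; exists i => //.
  by have [l' -> _] := heap_iter_prefix ia ea.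
by apply/mapP; exists i; rewrite ?mem_iota // ei.
Qed.

(** Skipping a loop between steps [i < j] would give the earlier return [i + (a - j)]. *)
Lemma first_return_inj P h p a t i j : t \in P -> heap_iter h a p = Some t ->
  (forall i r, 0 < i -> heap_iter h i p = Some r -> r \in P -> a <= i) ->
  i < a -> j < a -> heap_iter h i p = heap_iter h j p -> i = j.
Proof.
move=> tP ea fi; wlog ij : i j / i <= j => [H|] ia ja e.
  by case/orP: (leq_total i j) => ?; [|apply/esym]; apply: H.
have e' : heap_iter h (i + (a - j)) p = Some t.
  by rewrite heap_iterD e -heap_iterD subnKC // ltnW.
by have := fi _ _ _ e' tP; lia.
Qed.

Lemma block_inj P h p B t i j : block P h p B t -> i < #|` B| -> j < #|` B| ->
  heap_iter h i p = heap_iter h j p -> i = j.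
Proof.
move=> [ex _ fi] iB; have [tP et] := ex (leq_ltn_trans (leq0n i) iB).
apply: first_return_inj tP et _ iB => k r k0 e rP.
by have /andP[] := fi _ _ k0 e rP.
Qed.

Lemma block_first_return P h p a t : 0 < a -> t \in P ->
  heap_iter h a p = Some t ->
  (forall i r, 0 < i -> heap_iter h i p = Some r -> r \in P -> a <= i) ->
  #|` path_cells h p a| = a /\ block P h p (path_cells h p a) t.
Proof.
move=> a0 tP ea fi.
have ca : #|` path_cells h p a| = a.
  rewrite card_fseq undup_id ?size_map ?size_iota // map_inj_in_uniq ?iota_uniq //.
  move=> i j; rewrite !mem_iota /= => ia ja e.
  apply: (first_return_inj tP ea fi ia ja).
  have [? ei _] := heap_iter_prefix ia ea; have [? ej _] := heap_iter_prefix ja ea.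
  by move: e; rewrite ei ej /= => ->.
split=> //; split; rewrite ca //; first by move=> l; apply: path_cellsP ea.
by move=> i r i0 e rP; rewrite a0 (fi _ _ i0 e rP).
Qed.

Lemma block_no_return P h p t :
  (forall i r, 0 < i -> heap_iter h i p = Some r -> r \notin P) ->
  block P h p fset0 t.
Proof.
move=> nr; split=> [|l|i r i0 e]; rewrite ?cardfs0 //.
  by rewrite inE; split=> // -[].
by rewrite (negbTE (nr _ _ i0 e)).
Qed.

Lemma block_exists P h p : exists B t, block P h p B t.
Proof.
pose Q i := (0 < i) && (if heap_iter h i p is Some r then r \in P else false).
have [exQ|nQ] := pselect (exists i, Q i).
  case: (ex_minnP exQ) => a /andP[a0]; case ea: (heap_iter h a p) => [t|] // tP amin.
  exists (path_cells h p a), t.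
  apply: (block_first_return a0 tP ea _).2 => i r i0 e rP.
  by apply: amin; rewrite /Q i0 e.
exists fset0, p; apply: block_no_return => i r i0 e; apply/negP => rP.
by apply: nQ; exists i; rewrite /Q i0 e.
Qed.

(** Two blocks that meet are followed backwards. A block contains a point of [P] only as its first
    cell, so before that the common location is unmarked, and its predecessors coincide since
    distinct ones merge only in [P]. The starting points are thus equal. *)
Lemma decomp_exists h P T : marking h P T ->
  exists (B : LOC -> {fset LOC}) (t : LOC -> LOC), decomp P h B t.
Proof.
move=> [PT cl mg].
have /choice[B /choice[t bl]] := block_exists P h.
exists B, t; split=> // p r pP rP pr.
have itT q i l : q \in P -> heap_iter h i q = Some l -> l \in T.
  move=> qP; elim: i l => [|i IH] l /=; first by move=> [<-]; apply: (fsubsetP PT).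
  by case e: (heap_iter h i q) => [l'|] //=; apply: cl; apply: IH.
have inP q i l : i < #|` B q| -> heap_iter h i q = Some l -> l \in P -> i = 0.
  move=> iB e lP; case: i => // i in iB e *.
  by have /andP[_] := block_first (bl q) (ltn0Sn i) e lP; rewrite leqNgt iB.
suff meet i j l : i < #|` B p| -> j < #|` B r| -> heap_iter h i p = Some l ->
    heap_iter h j r = Some l -> p = r.
  apply/fdisjointP => l /(block_cells (bl p))[i iB ei]; apply/negP.
  move=> /(block_cells (bl r))[j jB ej].
  by rewrite (meet _ _ _ iB jB ei ej) eqxx in pr.
elim: i j l => [|i IH] j l iB jB.
  move=> [<-] ej; have := inP _ _ _ jB ej pP => j0.
  by move: ej; rewrite j0 => -[].
move=> ei ej; have lP : l \notin P by apply/negP => /(inP _ _ _ iB ei).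
case: j => [|j] in jB ej *; first by move: ej lP => -[<-]; rewrite rP.
move: ei ej => /=; case ei: (heap_iter h i p) => [l1|] //= e1.
case ej: (heap_iter h j r) => [l2|] //= e2.
have [e12|l12] := eqVneq l1 l2; last first.
  by rewrite (mg _ _ _ (itT _ _ _ pP ei) (itT _ _ _ rP ej) l12 e1 e2) in lP.
by apply: (IH j l1); rewrite ?(ltnW iB) ?(ltnW jB) // e12.
Qed.

(** * A small similar heap *)

Lemma decomp_shrink P n h (B : LOC -> {fset LOC}) t : decomp P h B t ->
  exists h', sim P n h h' /\ #|` domf h'| <= #|` P| * n.+1 + n.
Proof.
move=> dc; have [bl dj] := dc; pose a p := #|` B p|.
(* The [n]-th cell of a long block is its last kept cell, and is redirected
   to [t p]. *)
pose redirect p l := [/\ p \in P, n < a p & heap_iter h n p = Some l].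
(* A location is redirected for at most one [p], by injectivity along a block and disjointness of
   blocks; hence the new heap is well defined. *)
have redirect_uniq p r i l : p \in P -> i < a p -> heap_iter h i p = Some l ->
    redirect r l -> p = r /\ i = n.
  move=> pP ia e [rP na er]; have [pr|pr] := eqVneq p r.
    rewrite -pr in na er; split=> //.
    by apply: block_inj (bl _ pP) ia na _; rewrite e er.
  have lp : l \in B p by apply/(block_cells (bl _ pP)); exists i.
  have lr : l \in B r by apply/(block_cells (bl _ rP)); exists n.
  by move: (fdisjointP (dj _ _ pP rP pr) l lp); rewrite lr.
have /choice[F FP] : forall l, exists m, (forall p, redirect p l -> m = t p) /\
    ((forall p, ~ redirect p l) -> l \in domf h -> h.[? l] = Some m).
  move=> l; have [[p rp]|nr] := pselect (exists p, redirect p l).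
    exists (t p); split=> [r|]; last by move=> /(_ p).
    by have [pP na e] := rp; case/(redirect_uniq _ _ _ _ pP na e) => ->.
  exists (odflt l h.[? l]); split=> [p rp|_].
    by case: nr; exists p.
  by rewrite -fndSome; case: h.[? l].
pose a' p := minn (a p) n.+1; pose C p := path_cells h p (a' p).
have CB p : p \in P -> C p `<=` B p.
  move=> pP; apply/fsubsetP => l; rewrite inE => /mapP[i].
  rewrite mem_iota /= => ia' el; have ia : i < a p by move: ia'; rewrite /a'; lia.
  have [_ e] := block_exit (bl _ pP) (leq_ltn_trans (leq0n _) ia).
  have [l' e' _] := heap_iter_prefix ia e.
  by apply/(block_cells (bl _ pP)); exists i => //; rewrite el e'.
have [G Gg cG] := fsubset_of_card (geq_minr n #|` garbage P h B|).
pose D := G `|` \bigcup_(p <- P) C p.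
have Dh : D `<=` domf h.
  rewrite fsubUset (fsubset_trans Gg (fsubsetDl _ _)) /=.
  apply/bigfcupsP => p pP _; apply: fsubset_trans (CB _ pP) _.
  exact: block_dom (bl _ pP).
pose h' : heap LOC := [fmap l : D => F (val l)].
have h'E l : h'.[? l] = if l \in D then Some (F l) else None.
  by case: fndP => lD; rewrite ?ffunE.
(* Only the cell of index [n] may change, so the first [n] steps along a block are those of [h]. *)
have iterE p i : p \in P -> i <= n -> i <= a p ->
    heap_iter h' i p = heap_iter h i p.
  move=> pP; elim: i => [//|i IH] i_n ia /=.
  rewrite IH ?(ltnW i_n) ?(ltnW ia) //.
  have [_ e] := block_exit (bl _ pP) (leq_ltn_trans (leq0n _) ia).
  have [l el lh] := heap_iter_prefix ia e; rewrite el /= h'E ifT; last first.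
    rewrite in_fsetU; apply/orP; right; apply/bigfcupP; exists p; rewrite ?pP //.
    rewrite inE; apply/mapP; exists i; last by rewrite el.
    by rewrite mem_iota /a' /=; lia.
  have [_ ->] := FP l => // r rr.
  by have [_ i_eq] := redirect_uniq _ _ _ _ pP ia el rr; lia.
have CE p : p \in P -> C p = path_cells h' p (a' p).
  move=> pP; rewrite /C /path_cells.
  suff /eq_in_map -> : {in iota 0 (a' p), (fun i => odflt p (heap_iter h i p)) =1
      (fun i => odflt p (heap_iter h' i p))} by [].
  by move=> i; rewrite mem_iota /a' /= => ia; rewrite iterE //; lia.
have cC p : p \in P -> #|` C p| = a' p /\ block P h' p (C p) (t p).
  move=> pP; have [a0|a_gt0] := posnP (a p).
    have C0 : C p = fset0 by apply/fsetP => l; rewrite !inE /a' a0 min0n.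
    rewrite C0 cardfs0 /a' a0 min0n; split=> //; apply: block_no_return => i r i0 e.
    (* A path of [h] that never returns to [P] meets no redirected cell, since in [h] such a cell
       also leads to [P]. *)
    have iter_h j l : heap_iter h' j p = Some l -> heap_iter h j p = Some l.
      elim: j l => [//|j IH] l /=; case ej: (heap_iter h' j p) => [l'|] //=.
      rewrite (IH _ ej) /= h'E; case: ifP => // l'D [<-].
      have [_ ->] := FP l' => // [q [qP na eq]|]; last exact: (fsubsetP Dh).
      have [tP et] := block_exit (bl _ qP) (leq_ltn_trans (leq0n _) na).
      have e' : heap_iter h (j + (a q - n)) p = Some (t q).
        by rewrite heap_iterD (IH _ ej) -eq -heap_iterD subnKC // ltnW.
      have j_gt0 : 0 < j + (a q - n) by lia.
      by have := block_first (bl _ pP) j_gt0 e' tP; rewrite -/(a p) a0.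
    apply/negP => /(block_first (bl _ pP) i0 (iter_h _ _ e)).
    by rewrite -/(a p) a0.
  have [tP et] := block_exit (bl _ pP) a_gt0.
  rewrite CE //; apply: block_first_return => //; first by rewrite /a'; lia.
    rewrite /a'; have [an|na] := leqP (a p) n.
      by rewrite (minn_idPl (leqW an)) iterE.
    (* A long block: the redirected cell of index [n] reaches [t p] at step [n.+1]. *)
    have [l el lh] := heap_iter_prefix na et.
    rewrite (minn_idPr na) /= iterE ?(ltnW na) // el /= h'E ifT; last first.
      rewrite in_fsetU; apply/orP; right; apply/bigfcupP; exists p; rewrite ?pP //.
      rewrite inE; apply/mapP; exists n; last by rewrite el.
      by rewrite mem_iota /a' /=; lia.
    by have [/(_ p) ->] := FP l.
  move=> i r i0 e rP; rewrite leqNgt; apply/negP => ia'.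
  have i_n : i <= n by move: ia'; rewrite /a'; lia.
  have i_a : i < a p by move: ia'; rewrite /a'; lia.
  rewrite iterE ?(ltnW i_a) // in e.
  by have := block_first (bl _ pP) i0 e rP; rewrite [_ <= i]leqNgt -/(a p) i_a andbF.
have djC : {in P &, forall p r, p != r -> [disjoint C p & C r]}.
  move=> p r pP rP pr; apply: fdisjointWl (CB _ pP) _.
  exact: fdisjointWr (CB _ rP) (dj _ _ pP rP pr).
have gC : garbage P h' C = G.
  apply/fsetP => l; rewrite in_fsetD in_fsetU; case: bigfcupP => [[p]|_] /=.
    rewrite andbT => pP /(fsubsetP (CB _ pP)) lB; apply/esym/negbTE/negP.
    by move/(fsubsetP Gg)/(fdisjointP (garbage_disj h B pP)); rewrite lB.
  by rewrite orbF.
exists h'; split.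
  exists B, C, t; split=> //.
  - by split=> // p pP; apply: (cC _ pP).2.
  - by move=> p pP; rewrite (cC _ pP).1 /eq_upto /a' /a; lia.
  - by rewrite gC cG /eq_upto; lia.
rewrite -(card_remainder _ djC) -/(garbage _ _ _) gC cG addnC leq_add ?geq_minl //.
apply: (@leq_trans (\sum_(p <- P) n.+1)).
  rewrite big_seq [X in _ <= X]big_seq; apply: leq_sum => p pP.
  apply: leq_trans (fsubset_leq_card (fsubsetIr _ _)) _.
  by rewrite (cC _ pP).1 geq_minr.
by rewrite big_const_seq count_predT iter_addn_0 mulnC.
Qed.

End Heaps.

Theorem theorem4p11 (PVAR LOC : choiceType)
  (PVAR_inf : countably_infinite PVAR) (LOC_inf : countably_infinite LOC)
  (q : nat) (x : q.-tuple PVAR) (x_uniq : uniq x)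
  (phi : form PVAR) (phi_vars : {subset form_vars phi <= x})
  (phi_sat : satisfiable LOC phi) :
  exists (s : store PVAR LOC) (h : heap LOC),
    sat s h phi /\
    #|` domf h| <= (q ^ 2 + q) * (tree_size phi + 1) + tree_size phi.
Proof.
have [s [h sh]] := phi_sat; exists s.
have [P [T [mk xP cP]]] := marking_exists h [seq s y | y <- x].
have [B [t dc]] := decomp_exists mk.
have [h' [hh' ch']] := decomp_shrink (tree_size phi) dc.
exists h'; split.
  by apply: sim_sat hh' sh => y /phi_vars yx; apply/xP/map_f.
apply: leq_trans ch' _; rewrite addn1 leq_add2r leq_mul2r /=.
(* There are at most [2 * q] marked points, and [q <= q ^ 2]. *)
by apply: leq_trans cP _; rewrite size_map size_tuple; nia.
Qed.
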